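(* Let $d\ge 1$ and let $X_1,\ldots,X_{d+2}$ be (possibly dependent) random vectors in $\mathbb{R}^{d+1}$ such that: ($\pm$) for every $(\varepsilon_1,\ldots,\varepsilon_{d+2})\in\{+1,-1\}^{d+2}$, the joint law of $(\varepsilon_1X_1,\ldots,\varepsilon_{d+2}X_{d+2})$ equals the joint law of $(X_1,\ldots,X_{d+2})$; (GP) for every $1\le j_1<\cdots<j_{d+1}\le d+2$, the vectors $X_{j_1},\ldots,X_{j_{d+1}}$ are linearly independent with probability $1$. Let $\mathcal{D}_{d+2,d+1}=\mathrm{pos}(X_1,\ldots,X_{d+2})$. Then, for all $m\in\{-1,0,1,\ldots,\lfloor d/2\rfloor\}$, $$ \mathbb{P}[\mathcal{D}_{d+2,d+1} \cap \mathbb{S}^d \text{ is of type } T_m^{d}] = \frac{\eta_{d,m}}{2^{d+2}} \binom{d+2}{m+1}. $$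
   Context: $\mathrm{pos}(x_1,\ldots,x_n)=\{\lambda_1x_1+\cdots+\lambda_nx_n:\lambda_1,\ldots,\lambda_n\ge0\}$ is the positive hull, and $\mathbb{S}^d$ is the unit sphere in $\mathbb{R}^{d+1}$. Types of spherical polytopes: let $C\subseteq\mathbb{R}^{d+1}$ be the positive hull of $d+2$ vectors in general linear position (any $d+1$ of them are linearly independent) and $Q=C\cap\mathbb{S}^d$. Let $f_j(Q):=f_{j+1}(C)$ denote the number of $j$-dimensional faces of $Q$, i.e. of $(j+1)$-dimensional faces of the cone $C$. For $m\in\{-1,0,\ldots,\lfloor d/2\rfloor\}$, $Q$ is said to be of type $T_m^d$ if $f_{d-1}(Q)=(m+1)(d+1-m)$. In particular, $Q$ is of type $T_{-1}^d$ if $Q=\mathbb{S}^d$, of type $T_0^d$ if $Q$ is a spherical simplex, and otherwise $Q$ has $d+2$ vertices and is of one of the types $T_1^d,\ldots,T^d_{\lfloor d/2\rfloor}$. $\eta_{d,m}:=2$ if $m\ne d/2$, and $\eta_{d,m}:=1$ if $m=d/2$. *)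

(* Defs.v *)
From HB Require Import structures.
From mathcomp Require Import all_boot all_order all_algebra.
From mathcomp Require Import all_classical all_reals all_analysis.

Set Implicit Arguments.
Unset Strict Implicit.
Unset Printing Implicit Defensive.

Import Order.TTheory GRing.Theory Num.Theory.
Import numFieldNormedType.Exports.

Local Open Scope classical_set_scope.
Local Open Scope ring_scope.

Definition dotp (R : realType) (n : nat) (u v : 'rV[R]_n) : R :=
  \sum_(i < n) u 0 i * v 0 i.

(* The library norm on row vectors is the sup norm, so the Euclidean sphere is
   written with [dotp]. *)
Definition unit_sphere (R : realType) (n : nat) : set 'rV[R]_n :=
  [set v | dotp v v = 1].

Arguments unit_sphere R n : clear implicits.

Definition pos_hull (R : realType) (n k : nat) (x : 'I_k -> 'rV[R]_n) :
    set 'rV[R]_n :=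
  [set v | exists lam : 'I_k -> R,
             (forall i, 0 <= lam i) /\ v = \sum_(i < k) lam i *: x i].

(* n + 1 vectors of R^n, any n of which are linearly independent. *)
Definition general_position (R : realType) (n : nat)
    (x : 'I_n.+1 -> 'rV[R]_n) : Prop :=
  forall s : 'I_n -> 'I_n.+1, {homo s : i j / (i < j)%N} ->
    row_free (\matrix_(i < n) x (s i)).

(* Faces of a convex cone: its intersections with supporting hyperplanes
   through the origin, together with the cone itself (the case u = 0). *)
Definition cone_face (R : realType) (n : nat) (C F : set 'rV[R]_n) : Prop :=
  exists u : 'rV[R]_n, (forall v, C v -> 0 <= dotp u v) /\
    F = C `&` [set v | dotp u v = 0].

Definition linear_hull (R : realType) (n : nat) (F : set 'rV[R]_n)
    (V : {vspace 'rV[R]_n}) : Prop :=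
  (forall v, F v -> v \in V) /\
  (forall W : {vspace 'rV[R]_n}, (forall v, F v -> v \in W) -> (V <= W)%VS).

Definition cone_dim (R : realType) (n : nat) (F : set 'rV[R]_n) (j : nat) :
    Prop :=
  exists V : {vspace 'rV[R]_n}, linear_hull F V /\ \dim V = j.

(* f_j(C) = N *)
Definition cone_face_number (R : realType) (n : nat) (C : set 'rV[R]_n)
    (j N : nat) : Prop :=
  ([set F | cone_face C F /\ cone_dim F j] #= `I_N)%card.

(* The cone C such that Q is the intersection of C with the sphere (when C is
   not reduced to the origin). *)
Definition cone_over (R : realType) (n : nat) (Q : set 'rV[R]_n) :
    set 'rV[R]_n :=
  [set v | exists t q, [/\ 0 <= t, Q q & v = t *: q]].

(* f_j(Q) := f_{j+1}(C) *)
Definition spherical_face_number (R : realType) (n : nat) (Q : set 'rV[R]_n)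
    (j N : nat) : Prop :=
  cone_face_number (cone_over Q) j.+1 N.

(* Q is of type T_m^d, i.e. f_{d-1}(Q) = (m+1)(d+1-m).  This is meant for
   d >= 1, -1 <= m <= d/2 (so that the product is nonnegative and [absz] is
   harmless), and for Q cut out by the positive hull of d+2 vectors in general
   position. *)
Definition of_type (R : realType) (d : nat) (m : int) (Q : set 'rV[R]_d.+1) :
    Prop :=
  spherical_face_number Q d.-1 `|((m + 1) * (d%:Z + 1 - m))%R|%N.

Definition eta_coef (d : nat) (m : int) : nat :=
  if m * 2 == d%:Z then 1%N else 2%N.

(* Matrices with their Borel sigma-algebra. *)
Definition borel_mx (R : realType) (k n : nat) :=
  g_sigma_algebraType (@open 'M[R]_(k, n)).

Definition same_law (dT : measure_display) (T : measurableType dT)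
    (R : realType) (P : probability T R) (k n : nat) (Y Z : T -> 'M[R]_(k, n)) :
    Prop :=
  forall A : set (borel_mx R k n), measurable A ->
    pushforward P (Y : T -> borel_mx R k n) A =
    pushforward P (Z : T -> borel_mx R k n) A.

(* Main.v *)
(* Vectors x_1, ..., x_(d+2) in general position in R^(d+1) satisfy a single
   linear relation sum_i c_i x_i = 0 up to scaling, and no c_i vanishes.  A
   facet of their positive hull omits exactly two generators, and omitting x_i
   and x_j gives a facet iff c_i and c_j have opposite signs, since
   c_i <u, x_i> + c_j <u, x_j> = 0 for a normal vector u.  So if p of the c_i
   are positive there are p (d + 2 - p) facets, and the type is T_m iff
   p = m + 1 or p = d + 1 - m.  Up to a global sign, replacing x_i by eps_i x_i
   replaces c_i by eps_i c_i; hence exactly eta * binomial(d + 2, m + 1) of the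
   2^(d+2) sign changes of a fixed configuration have type T_m, and by (+-) the
   probability is the average of this constant. *)
Require Import Defs.
From HB Require Import structures.
From mathcomp Require Import all_boot all_order all_fingroup all_algebra.
From mathcomp Require Import all_classical all_reals all_analysis.
From mathcomp Require Import measurable_realfun zify.

Import Order.TTheory GRing.Theory Num.Theory.
Import numFieldNormedType.Exports.

Local Open Scope classical_set_scope.
Local Open Scope ring_scope.

Set Implicit Arguments.
Unset Strict Implicit.
Unset Printing Implicit Defensive.

(** * The linear relation among n + 1 vectors, by signed maximal minors *)

Definition dep_coef (R : comPzRingType) (n : nat) (M : 'M[R]_(n.+1, n))
    (i : 'I_n.+1) : R := (-1) ^+ i * \det (row' i M).

Lemma sum_dep_coef (R : comPzRingType) (n : nat) (M : 'M[R]_(n.+1, n)) :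
  \sum_i dep_coef M i *: row i M = 0.
Proof.
apply/rowP => k; rewrite summxE mxE.
(* Expand along its first column the determinant of [M] bordered by a copy of
   its [k]-th column. *)
pose B : 'M[R]_n.+1 :=
  \matrix_(i, j) if unlift ord0 j is Some j' then M i j' else M i k.
have B0 : \det B = 0.
  rewrite -det_tr.
  apply: (determinant_alternate (i1 := ord0) (i2 := lift ord0 k)) => // l.
  by rewrite !mxE unlift_none liftK.
apply: etrans B0; rewrite (expand_det_col B ord0).
apply: eq_bigr => i _; rewrite !mxE unlift_none mulrC; congr (_ * _).
rewrite /cofactor /dep_coef addn0; congr (_ * \det _).
by apply/matrixP => r s; rewrite !mxE liftK.
Qed.

Lemma dep_coef_neq0 (F : fieldType) (n : nat) (M : 'M[F]_(n.+1, n))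
    (i : 'I_n.+1) : (dep_coef M i != 0) = row_free (row' i M).
Proof.
by rewrite /dep_coef mulrI_eq0 ?row_free_unit ?unitmxE ?unitfE//; apply/lregP;
  rewrite signr_eq0.
Qed.

Lemma dep_coef_scale (F : comPzRingType) (n : nat) (M : 'M[F]_(n.+1, n))
    (eps : 'I_n.+1 -> F) (i : 'I_n.+1) :
  dep_coef (\matrix_l (eps l *: row l M)) i =
  \prod_r eps (lift i r) * dep_coef M i.
Proof.
rewrite /dep_coef mulrCA; congr (_ * _).
have -> : row' i (\matrix_l (eps l *: row l M)) =
    diag_mx (\row_r eps (lift i r)) *m row' i M.
  by apply/matrixP => r s; rewrite mul_diag_mx !mxE.
rewrite det_mulmx det_diag; congr (_ * _).
by apply: eq_bigr => r _; rewrite mxE.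
Qed.

Lemma lift_homo_ltn (n : nat) (i : 'I_n.+1) :
  {homo lift i : j k / (j < k)%N}.
Proof. by move=> j k; rewrite /= !ltnNge leq_bump2. Qed.

(** An increasing choice of [n] among [n.+1] indices omits exactly one index, so general position
    only concerns the minors obtained by deleting one row. *)
Lemma general_position_dep_coef (R : realType) (n : nat)
    (M : 'M[R]_(n.+1, n)) :
  general_position (fun i => row i M) <-> forall i, dep_coef M i != 0.
Proof.
split=> [gp i|dep s s_homo].
  rewrite dep_coef_neq0; have := gp _ (@lift_homo_ltn n i).
  by congr (is_true (row_free _)); apply/matrixP => r k; rewrite !mxE.
have s_inj : injective s.
  move=> j k sjk; apply/val_inj/eqP; case: ltngtP => // /s_homo;
  by rewrite sjk ltnn.
have [i i_s] : exists i, i \notin codom s.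
  apply/existsP; rewrite -negb_forall; apply/negP => /forallP s_surj.
  have /eq_card : codom s =i predT by move=> i; rewrite s_surj.
  by rewrite card_codom// cardT/= size_enum_ord card_ord => /eqP; rewrite ltn_eqF.
have s_lift j : {k | s j = lift i k}.
  have := codom_f s j; case: (unliftP i (s j)) => [k -> _|sji]; first by exists k.
  by move=> sjs; exfalso; rewrite -sji sjs in i_s.
pose t j := sval (s_lift j).
have st j : s j = lift i (t j) by rewrite /t; case: (s_lift j).
have t_inj : injective t by move=> j k tjk; apply: s_inj; rewrite !st tjk.
(* Since [s] misses [i], it lists the rows of [row' i M] in some order, and reordering rows keeps
   them independent. *)
have -> : \matrix_j row (s j) M = row_perm (perm t_inj) (row' i M).
  by apply/matrixP => r k; rewrite !mxE permE st.
rewrite row_free_unit row_permE unitmx_mul unitmx_perm -row_free_unit.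
by rewrite -dep_coef_neq0 dep.
Qed.

(** A relation whose [i]-th coefficient vanishes only involves the rows of [row' i M], which are
    independent. *)
Lemma dep_coef_unique (F : fieldType) (n : nat) (M : 'M[F]_(n.+1, n))
    (i : 'I_n.+1) (a : 'I_n.+1 -> F) :
  dep_coef M i != 0 -> \sum_l a l *: row l M = 0 -> a i = 0 ->
  forall l, a l = 0.
Proof.
rewrite dep_coef_neq0 => free_i + ai0.
rewrite (bigD1_ord i)//= ai0 scale0r add0r => sum0.
have : (\row_r a (lift i r)) *m row' i M == 0.
  apply/eqP; apply: etrans sum0; rewrite mulmx_sum_row; apply: eq_bigr => r _.
  by rewrite mxE; congr (_ *: _); apply/rowP => k; rewrite !mxE.
rewrite mulmx_free_eq0// => /eqP/rowP a0 l.
by case: (unliftP i l) => [r ->|->//]; have := a0 r; rewrite !mxE.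
Qed.

(** * Faces and facets of a positive hull *)

Lemma dotp_suml (R : realType) (n k : nat) (u : 'rV[R]_n) (a : 'I_k -> R)
    (x : 'I_k -> 'rV[R]_n) :
  dotp u (\sum_i a i *: x i) = \sum_i a i * dotp u (x i).
Proof.
rewrite /dotp; under eq_bigr do rewrite summxE mulr_sumr.
rewrite exchange_big; apply: eq_bigr => i _.
by rewrite mulr_sumr; apply: eq_bigr => j _; rewrite mxE mulrCA.
Qed.

(** The rows other than [j] form an invertible matrix, so the products of [u] with them can be
    prescribed at will. *)
Lemma dotp_dual (R : realType) (n : nat) (M : 'M[R]_(n.+1, n))
    (i j : 'I_n.+1) : dep_coef M j != 0 ->
  exists u, forall l, l != j -> dotp u (row l M) = (l == i)%:R.
Proof.
rewrite dep_coef_neq0 row_free_unit => unitM.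
pose y : 'cV[R]_n := \col_r (lift j r == i)%:R.
exists (invmx (row' j M) *m y)^T => l.
case: (unliftP j l) => [r -> _|->]; last by rewrite eqxx.
have /colP/(_ r) := mulKVmx unitM y; rewrite !mxE => <-.
by apply: eq_bigr => k _; rewrite !mxE mulrC.
Qed.

Definition pos_hull_on (R : realType) (n k : nat) (x : 'I_k -> 'rV[R]_n)
    (Z : {set 'I_k}) : set 'rV[R]_n :=
  [set v | exists lam : 'I_k -> R, [/\ forall i, 0 <= lam i,
             forall i, i \notin Z -> lam i = 0 & v = \sum_i lam i *: x i]].

Lemma mem_pos_hull_on (R : realType) (n k : nat) (x : 'I_k -> 'rV[R]_n)
    (Z : {set 'I_k}) (l : 'I_k) : l \in Z -> pos_hull_on x Z (x l).
Proof.
move=> lZ; exists (fun i => (i == l)%:R); split=> [i|i|]; first exact: ler0n.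
- by case: eqVneq => // ->; rewrite lZ.
- by rewrite (bigD1 l)//= eqxx scale1r big1 ?addr0// => i /negPf ->; rewrite scale0r.
Qed.

Lemma mem_pos_hull (R : realType) (n k : nat) (x : 'I_k -> 'rV[R]_n) (l : 'I_k) :
  pos_hull x (x l).
Proof.
have [lam [lam0 _ xE]] := mem_pos_hull_on x (finset.in_setT l).
by exists lam.
Qed.

(** A sum of nonnegative terms vanishes only if every term does, so the coefficients vanish at each
    generator not orthogonal to [u]. *)
Lemma pos_hull_cut (R : realType) (n k : nat) (x : 'I_k -> 'rV[R]_n)
    (u : 'rV[R]_n) : (forall v, pos_hull x v -> 0 <= dotp u v) ->
  pos_hull x `&` [set v | dotp u v = 0] =
  pos_hull_on x [set l | dotp u (x l) == 0]%SET.
Proof.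
move=> u0; apply/seteqP; split=> v.
- move=> [[lam [lam0 ->]]]; rewrite /= dotp_suml => /psumr_eq0P sum0.
  exists lam; split=> // i; rewrite inE => uxi.
  have /eqP := sum0 (fun l _ => mulr_ge0 (lam0 l) (u0 _ (mem_pos_hull x l))) i isT.
  by rewrite mulf_eq0 (negPf uxi) orbF => /eqP.
- move=> [lam [lam0 lamZ ->]]; split; first by exists lam.
  rewrite /= dotp_suml big1// => i _.
  have [|/lamZ ->] := boolP (i \in [set l | dotp u (x l) == 0]%SET); last by rewrite mul0r.
  by rewrite inE => /eqP ->; rewrite mulr0.
Qed.

Lemma linear_hull_pos_hull_on (R : realType) (n k : nat)
    (x : 'I_k -> 'rV[R]_n) (Z : {set 'I_k}) :
  linear_hull (pos_hull_on x Z) (\sum_(l in Z) <[x l]>)%VS.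
Proof.
split=> [v [lam [_ lamZ ->]]|W FW].
- apply: memv_suml => i _.
  have [iZ|/lamZ ->] := boolP (i \in Z); last by rewrite scale0r mem0v.
  by apply/(subvP (sumv_sup i iZ (subvv _)))/memvZ/memv_line.
- by apply/subv_sumP => i iZ; rewrite -memvE; apply/FW/mem_pos_hull_on.
Qed.

Lemma linear_hull_inj (R : realType) (n : nat) (F : set 'rV[R]_n)
    (V W : {vspace 'rV[R]_n}) : linear_hull F V -> linear_hull F W -> V = W.
Proof.
move=> [FV minV] [FW minW]; apply/eqP; rewrite eqEsubv.
by rewrite minV// minW.
Qed.

Lemma row_dep_neq0 (F : fieldType) (n : nat) (M : 'M[F]_(n.+1, n))
    (i l : 'I_n.+1) : dep_coef M i != 0 -> l != i -> row l M != 0.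
Proof.
move=> ci li; apply/eqP => row0.
have /(_ l)/eqP : forall j, (j == l)%:R = 0 :> F; last by rewrite eqxx oner_eq0.
apply: (dep_coef_unique ci); last by rewrite eq_sym (negPf li).
by rewrite big1// => j _; case: eqVneq => [->|]; rewrite ?row0 ?scaler0 ?scale0r.
Qed.

(** Once row [i] is left out, the remaining rows are independent, so the lines they span are in
    direct sum. *)
Lemma dimv_sum_rows (R : fieldType) (n : nat) (M : 'M[R]_(n.+1, n))
    (Z : {set 'I_n.+1}) (i : 'I_n.+1) : dep_coef M i != 0 -> i \notin Z ->
  \dim (\sum_(l in Z) <[row l M]>)%VS = #|Z|.
Proof.
move=> ci iZ.
have indep (a : 'I_n.+1 -> R) : (forall l, l \notin Z -> a l = 0) ->
    \sum_l a l *: row l M = 0 -> forall l, a l = 0.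
  by move=> aZ sum0; apply: (dep_coef_unique ci sum0); apply: aZ.
have /directvP/= -> : directv (\sum_(l in Z) <[row l M]>).
  apply/directv_sum_independent => us usZ sum0 l lZ.
  have [a aE] : exists a : 'I_n.+1 -> R, forall j, j \in Z -> us j = a j *: row j M.
    suff /boolp.choice[a aE] : forall j, exists b, j \in Z -> us j = b *: row j M.
      by exists a.
    move=> j.
    have [/usZ/vlineP[b ->]|] := boolP (j \in Z); last by exists 0.
    by exists b.
  have := indep (fun j => if j \in Z then a j else 0) _ _ l.
  rewrite aE// lZ => -> //; first by rewrite scale0r.
    by move=> j /negPf ->.
  rewrite -[RHS]sum0 [RHS]big_mkcond; apply: eq_bigr => j _.
  by case: ifP => [/aE ->|]; rewrite ?scale0r.
rewrite -sum1_card; apply: eq_bigr => l lZ.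
by rewrite dim_vline (row_dep_neq0 ci)//; apply: contraNneq iZ => <-.
Qed.

Lemma cone_dim_pos_hull_on (R : realType) (d : nat) (M : 'M[R]_(d.+2, d.+1))
    (Z : {set 'I_d.+2}) : (forall i, dep_coef M i != 0) ->
  cone_dim (pos_hull_on (fun i => row i M) Z) d <-> #|Z| = d.
Proof.
move=> c0; have hullZ := linear_hull_pos_hull_on (fun i => row i M) Z.
have -> : cone_dim (pos_hull_on (fun i => row i M) Z) d <->
    \dim (\sum_(l in Z) <[row l M]>)%VS = d.
  split=> [[V [hullV]]|dimZ]; first by rewrite (linear_hull_inj hullZ hullV).
  by exists (\sum_(l in Z) <[row l M]>)%VS.
have [->|] := eqVneq Z (finset.setT : {set 'I_d.+2}); last first.
  rewrite -finset.subTset => /subsetPn[i _ iZ].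
  by rewrite (dimv_sum_rows (c0 i) iZ).
(* With all rows in [Z] both sides fail: the cardinality is [d.+2], while the rows other than [ord0]
   already span dimension [d.+1]. *)
rewrite cardsT card_ord; split=> [dimd|/esym/eqP]; last by rewrite ltn_eqF.
have i_C : (ord0 : 'I_d.+2) \notin [set~ ord0]%SET by rewrite !inE eqxx.
have := dimv_sum_rows (c0 ord0) i_C; rewrite cardsC1 card_ord/= => dim_C.
have : (\sum_(l in [set~ ord0 : 'I_d.+2]%SET) <[row l M]> <=
        \sum_(l in (finset.setT : {set 'I_d.+2})) <[row l M]>)%VS.
  by apply/subv_sumP => l _; apply: sumv_sup (subvv _).
by move/dimvS; rewrite dim_C dimd ltnn.
Qed.

(** Take [u] with product 1 on row [i] and 0 on the rows other than [i] and [j]. The linear relation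
    then forces the value [- (c i / c j)] on row [j], which is positive because the signs are
    opposite. *)
Lemma facet_support (R : realType) (n : nat) (M : 'M[R]_(n.+1, n))
    (i j : 'I_n.+1) : dep_coef M i * dep_coef M j < 0 ->
  exists2 u, forall l, 0 <= dotp u (row l M) &
    forall l, (dotp u (row l M) == 0) = (l \in ~: [set i; j]%SET).
Proof.
set c := dep_coef M => cij.
have cj0 : c j != 0 by apply: contraTneq cij => ->; rewrite mulr0 ltxx.
have ci0 : c i != 0 by apply: contraTneq cij => ->; rewrite mul0r ltxx.
have ij : i != j by apply: contraTneq cij => ->; rewrite -leNgt -expr2 sqr_ge0.
have [u uE] := dotp_dual i cj0.
have uj : dotp u (row j M) = - (c i / c j).
  have : \sum_l c l * dotp u (row l M) = 0.
    by rewrite -dotp_suml sum_dep_coef /dotp big1// => l _; rewrite mxE mulr0.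
  rewrite (bigD1 j)//= (bigD1 i)//= (uE i)// eqxx mulr1 big1 ?addr0; last first.
    by move=> l /andP[lj /negPf li]; rewrite uE// li mulr0.
  by move/eqP; rewrite addr_eq0 => /eqP cju; apply: (mulfI cj0);
    rewrite cju mulrN mulrCA divff// mulr1.
have uj0 : 0 < dotp u (row j M).
  (* Multiplying [c i / c j] by the positive square of [c j] gives [c i * c j], whose sign is
     known. *)
  by rewrite uj oppr_gt0 -(pmulr_llt0 (x := c j ^+ 2)) ?exprn_even_gt0// expr2 mulrA
    mulfVK.
exists u => l; have [->|lj] := eqVneq l j.
- exact: ltW.
- by rewrite uE// ler0n.
- by rewrite gt_eqF// !inE eqxx orbT.
- by rewrite uE// !inE (negPf lj) orbF pnatr_eq0 eqb0.
Qed.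

Lemma facetP (R : realType) (d : nat) (M : 'M[R]_(d.+2, d.+1))
    (F : set 'rV[R]_d.+1) : (forall i, dep_coef M i != 0) ->
  cone_face (pos_hull (fun i => row i M)) F /\ cone_dim F d <->
  exists i j, [/\ 0 < dep_coef M i, dep_coef M j < 0 &
                  F = pos_hull_on (fun i => row i M) (~: [set i; j])%SET].
Proof.
move=> c0; split=> [[[u [u0 ->]]]|[i [j [ci cj ->]]]].
  have x0 l : 0 <= dotp u (row l M) by apply/u0/mem_pos_hull.
  rewrite pos_hull_cut// cone_dim_pos_hull_on//.
  set Z := [set l | _]%SET => Zd.
  (* [Z] has [d] of the [d.+2] indices, so exactly two generators lie off the hyperplane. *)
  have /eqP/cards2P[i [j [ij ZE]]] : #|~: Z| = 2%N.
    by apply/eqP; rewrite -(eqn_add2l #|Z|) cardsC card_ord Zd addn2.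
  have gt0 l : l \in ~: Z -> 0 < dotp u (row l M).
    by rewrite !inE lt0r x0 andbT.
  have ui : 0 < dotp u (row i M) by apply: gt0; rewrite ZE !inE eqxx.
  have uj : 0 < dotp u (row j M) by apply: gt0; rewrite ZE !inE eqxx orbT.
  have : \sum_l dep_coef M l * dotp u (row l M) = 0.
    by rewrite -dotp_suml sum_dep_coef /dotp big1// => l _; rewrite mxE mulr0.
  rewrite (bigD1 i)//= (bigD1 j) 1?eq_sym//= big1 ?addr0; last first.
    move=> l /andP[li lj]; suff : l \in Z by rewrite inE => /eqP ->; rewrite mulr0.
    by rewrite -[Z]finset.setCK ZE !inE negb_or li.
  move=> sum0.
  have -> : Z = (~: [set i; j])%SET by rewrite -ZE finset.setCK.
  (* The two surviving terms of the relation cancel while both products with [u] are positive; the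
     sign of the coefficient at [i] decides which index is the positive one. *)
  have [ci|ci] := ltP 0 (dep_coef M i); [exists i, j|exists j, i].
    split=> //; rewrite -(pmulr_llt0 _ uj) -(addKr (dep_coef M i * dotp u (row i M)) (_ * _)) sum0.
    by rewrite addr0 oppr_lt0 mulr_gt0.
  have ci' : dep_coef M i < 0 by rewrite lt_neqAle c0.
  split=> //; last by rewrite finset.setUC.
  rewrite -(pmulr_lgt0 _ uj) -(addKr (dep_coef M i * dotp u (row i M)) (_ * _)) sum0.
  by rewrite addr0 oppr_gt0 pmulr_llt0.
have ij : i != j by apply: contraTneq ci => ->; rewrite -leNgt ltW.
split; last first.
  apply/cone_dim_pos_hull_on => //; apply/eqP.
  by rewrite -(eqn_add2l #|[set i; j]%SET|) cardsC card_ord cards2 ij add2n.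
have [|u u0 uE] := @facet_support _ _ M i j; first by rewrite pmulr_rlt0.
have hull_ge0 v : pos_hull (fun i => row i M) v -> 0 <= dotp u v.
  move=> [lam [lam0 ->]]; rewrite dotp_suml sumr_ge0// => l _.
  by rewrite mulr_ge0.
exists u; split => //; rewrite pos_hull_cut//; congr pos_hull_on.
by apply/setP => l; rewrite -uE inE.
Qed.

Lemma card_eq_finset (T : finType) (A : {set T}) : ([set` A] #= `I_#|A|)%card.
Proof.
have idx_inj : {in [set` A] &, injective (fun x => index x (enum A))}.
  move=> x y; rewrite !classical_sets.in_setE/= => xA yA idx.
  by rewrite -(nth_index x (s := enum A) (x := x)) ?mem_enum// idx nth_index ?mem_enum.
rewrite -(card_eq_sym).
have -> : `I_#|A| = (fun x => index x (enum A)) @` [set` A].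
  apply/seteqP; split=> [k kA|k [x xA <-]]; last first.
    by rewrite /= cardE index_mem mem_enum.
  exists (enum_val (Ordinal kA)); first exact: enum_valP.
  rewrite (enum_val_nth (enum_val (Ordinal kA))) index_uniq ?enum_uniq//.
  by rewrite -cardE.
exact: inj_card_eq.
Qed.

(** By [facetP], pairs of a positive and a negative index parametrise the facets; what remains is
    that a facet determines the pair it omits. *)
Lemma card_facets (R : realType) (d : nat) (M : 'M[R]_(d.+2, d.+1))
    (p := #|[set i | 0 < dep_coef M i]%SET|) :
  (forall i, dep_coef M i != 0) ->
  cone_face_number (pos_hull (fun i => row i M)) d (p * (d.+2 - p)).
Proof.
move=> c0; rewrite /cone_face_number.
pose pos := [set i | 0 < dep_coef M i]%SET.
pose phi (ij : 'I_d.+2 * 'I_d.+2) :=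
  pos_hull_on (fun i => row i M) (~: [set ij.1; ij.2])%SET.
have in_pos i : (i \in pos) = (0 < dep_coef M i) by rewrite inE.
have in_neg i : (i \in ~: pos) = (dep_coef M i < 0).
  by rewrite !inE -leNgt le_eqVlt (negPf (c0 i)).
have -> : [set F | cone_face (pos_hull (fun i => row i M)) F /\ cone_dim F d] =
    phi @` [set` finset.setX pos (~: pos)].
  apply/seteqP; split=> [F /= /(facetP _ c0)[i [j [ci cj ->]]]|F].
    by exists (i, j) => //=; rewrite inE in_pos in_neg ci.
  move=> [[i j]] /=; rewrite inE in_pos in_neg => /andP[ci cj] <-.
  by apply/facetP => //; exists i, j.
(* The supporting vector vanishes on the facet but is positive on rows [i] and [j], so neither row
   lies in the facet. *)
have memphi i j l : i \in pos -> j \in ~: pos -> phi (i, j) (row l M) ->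
    l \in (~: [set i; j])%SET.
  rewrite in_pos in_neg => ci cj [lam [lam0 lamZ lE]].
  have [|u u0 uE] := @facet_support _ _ M i j; first by rewrite pmulr_rlt0.
  rewrite -uE lE dotp_suml big1// => k _.
  have [|/lamZ ->] := boolP (k \in (~: [set i; j])%SET); last by rewrite mul0r.
  by rewrite -uE => /eqP ->; rewrite mulr0.
have phi_inj : {in [set` finset.setX pos (~: pos)] &, injective phi}.
  move=> [i j] [i' j']; rewrite !classical_sets.in_setE/= !finset.in_setX/=.
  move=> /andP[ipos jneg] /andP[i'pos j'neg] phi_eq.
  have sub l : l \in [set i'; j']%SET -> l \in [set i; j]%SET.
    apply: contraTT; rewrite -!finset.in_setC => lC.
    apply: memphi => //; rewrite -phi_eq.
    exact: (mem_pos_hull_on (fun i => row i M)).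
  (* Both [i'] and [j'] are among [i] and [j]; matching a positive index with a negative one is
     excluded by the signs. *)
  have /set2P[->|i'j] := sub i' (set21 _ _); last first.
    by move: jneg; rewrite -i'j finset.in_setC i'pos.
  have /set2P[j'i|->//] := sub j' (set22 _ _).
  by move: j'neg; rewrite j'i finset.in_setC ipos.
apply: card_eq_trans (inj_card_eq phi_inj) _.
have -> : (p * (d.+2 - p))%N = #|finset.setX pos (~: pos)|.
  by rewrite cardsX [#|~: pos|]cardsCs finset.setCK card_ord.
exact: card_eq_finset.
Qed.

(** * From facet counts to the type of the spherical polytope *)

Lemma cone_over_pos_hull (R : realType) (n k : nat) (x : 'I_k -> 'rV[R]_n)
    (l : 'I_k) : x l != 0 ->
  cone_over (pos_hull x `&` unit_sphere R n) = pos_hull x.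
Proof.
move=> xl0.
have normalize v : pos_hull x v -> v != 0 ->
    exists t q, [/\ 0 <= t, (pos_hull x `&` unit_sphere R n) q & v = t *: q].
  move=> [lam [lam0 vE]] v0.
  have vv0 : 0 < dotp v v.
    have sq0 i : 0 <= v 0 i * v 0 i by rewrite -expr2 sqr_ge0.
    rewrite lt0r sumr_ge0// andbT; apply: contraNneq v0 => /psumr_eq0P vi0.
    apply/eqP/rowP => i; rewrite mxE; apply/eqP.
    by rewrite -sqrf_eq0 expr2 vi0.
  set t := Num.sqrt (dotp v v); have t0 : 0 < t by rewrite sqrtr_gt0.
  exists t, (t^-1 *: v); split; first exact: ltW.
    split.
      exists (fun i => t^-1 * lam i); split=> [i|]; first by rewrite mulr_ge0// invr_ge0 ltW.
      by rewrite vE scaler_sumr; apply: eq_bigr => i _; rewrite scalerA.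
    rewrite /unit_sphere/=.
    have -> : dotp (t^-1 *: v) (t^-1 *: v) = t ^- 2 * dotp v v.
      rewrite /dotp mulr_sumr -exprVn; apply: eq_bigr => i _.
      by rewrite !mxE mulrACA.
    by rewrite -(sqr_sqrtr (ltW vv0)) mulVf// expf_neq0// gt_eqF.
  by rewrite scalerA divff ?scale1r// gt_eqF.
apply/seteqP; split=> [v [t [q [t0 [[lam [lam0 ->]] _] ->]]]|v vC].
  exists (fun i => t * lam i); split=> [i|]; first exact: mulr_ge0.
  by rewrite scaler_sumr; apply: eq_bigr => i _; rewrite scalerA.
have [->|/(normalize v vC)//] := eqVneq v 0.
(* The origin is 0 times a point of the sphere; the nonzero generator supplies such a point after
   normalization. *)
have [_ [q [_ Cq _]]] := normalize _ (mem_pos_hull x l) xl0.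
by exists 0, q; rewrite scale0r.
Qed.

(** Over the integers, the difference of the two products factors, up to sign, as (p - a)(p - (k -
    a)). *)
Lemma eq_mul_complement (k p a : nat) : (p <= k)%N -> (a <= k)%N ->
  ((p * (k - p) = a * (k - a)) <-> (p = a \/ p = k - a))%N.
Proof.
move=> pk ak; split=> [e|[|] ->]; [|by []|by rewrite subKn// mulnC].
have /eqP : (p%:Z - a%:Z) * (p%:Z - (k - a)%N%:Z) = 0.
  have := congr1 Posz e; rewrite !PoszM -!subzn//.
  lia.
by rewrite mulf_eq0 !subr_eq0 => /orP[] /eqP[->]; [left|right].
Qed.

(** With a = m + 1 the facet count prescribed by the type is a(d + 2 - a), to be compared with the
    actual count p(d + 2 - p). *)
Lemma of_type_dep_coef (R : realType) (d : nat) (m : int)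
    (M : 'M[R]_(d.+2, d.+1)) (a := `|(m + 1)%R|%N)
    (p := #|[set i | 0 < dep_coef M i]%SET|) :
  (1 <= d)%N -> -1 <= m <= (d./2)%:Z -> (forall i, dep_coef M i != 0) ->
  of_type m (pos_hull (fun i => row i M) `&` unit_sphere R d.+1) <->
  p = a \/ p = (d.+2 - a)%N.
Proof.
move=> d0 md c0.
have ak : (a <= d.+2)%N by rewrite /a; lia.
rewrite /of_type /spherical_face_number prednK//.
rewrite (@cone_over_pos_hull _ _ _ _ ord0); last first.
  exact: (row_dep_neq0 (c0 ord_max)).
have -> : `|((m + 1) * (d%:Z + 1 - m))%R|%N = (a * (d.+2 - a))%N.
  rewrite abszM /a; congr (_ * _)%N; lia.
rewrite -eq_mul_complement//; last first.
  by rewrite -[X in (_ <= X)%N](card_ord d.+2) max_card.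
have := card_facets c0; rewrite -/p /cone_face_number => facets.
split=> [facets'|<-//]; apply/(@card_eq_II _ _).
by rewrite (card_eq_trans _ facets')// card_eq_sym.
Qed.

(** * Sign changes of a fixed configuration, indexed by the set of flipped rows *)

Definition flip_rows (R : pzRingType) (n k : nat) (B : {set 'I_k})
    (M : 'M[R]_(k, n)) : 'M[R]_(k, n) :=
  \matrix_l ((-1) ^+ (l \in B) *: row l M).

(** The minor without row [i] picks up the signs of all other rows; as signs square to 1, this is
    the total sign times the sign of row [i]. *)
Lemma dep_coef_flip (R : comPzRingType) (n : nat) (M : 'M[R]_(n.+1, n))
    (B : {set 'I_n.+1}) (i : 'I_n.+1) :
  dep_coef (flip_rows B M) i = (-1) ^+ (odd #|B| (+) (i \in B)) * dep_coef M i.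
Proof.
rewrite /flip_rows dep_coef_scale; congr (_ * _).
have : \prod_l (-1) ^+ (l \in B) = (-1) ^+ #|B| :> R.
  by rewrite prodrXr -sum1_card [in RHS]big_mkcond.
rewrite (bigD1_ord i)//= signr_addb signr_odd => <-.
by rewrite mulrAC -expr2 sqrr_sign mul1r.
Qed.

Definition generic (R : realDomainType) (n : nat) (M : 'M[R]_(n.+1, n)) : bool :=
  [forall i, dep_coef M i != 0].

Definition pos_dep (R : realDomainType) (n : nat) (M : 'M[R]_(n.+1, n)) :
    {set 'I_n.+1} :=
  [set i | 0 < dep_coef M i]%SET.

Lemma generic_flip (R : realDomainType) (n : nat) (M : 'M[R]_(n.+1, n))
    (B : {set 'I_n.+1}) : generic (flip_rows B M) = generic M.
Proof.
by apply: eq_forallb => i; rewrite dep_coef_flip mulf_eq0 signr_eq0.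
Qed.

Definition symdiff (T : finType) (A B : {set T}) : {set T} :=
  [set i | (i \in A) (+) (i \in B)]%SET.

Lemma symdiffK (T : finType) (A : {set T}) : involutive (symdiff A).
Proof. by move=> B; apply/setP => i; rewrite !inE addKb. Qed.

(** Flipping an odd number of rows brings a global sign, which exchanges positive and negative
    coefficients; genericity rules out zeros. *)
Lemma pos_dep_flip (R : realDomainType) (n : nat) (M : 'M[R]_(n.+1, n))
    (B : {set 'I_n.+1}) : generic M ->
  pos_dep (flip_rows B M) = (if odd #|B| then ~: symdiff (pos_dep M) B
                             else symdiff (pos_dep M) B)%SET.
Proof.
move=> /forallP c0; apply/setP => i.
have -> : (i \in (if odd #|B| then ~: symdiff (pos_dep M) B
                   else symdiff (pos_dep M) B)%SET) =
    odd #|B| (+) (i \in symdiff (pos_dep M) B) by case: odd; rewrite ?inE.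
rewrite !inE dep_coef_flip [RHS]addbCA.
case: (odd #|B| (+) (i \in B)); last by rewrite mul1r addbF.
by rewrite mulN1r oppr_gt0 addbT -leNgt [in RHS]le_eqVlt (negPf (c0 i)).
Qed.

(** The relation is only defined up to a global sign, so the condition on the number [p] of positive
    coefficients has to be invariant under exchanging [p] and [k - p]. *)
Definition balanced (k a p : nat) : bool := (p == a) || (p == k - a)%N.

Lemma balanced_sub (k a p : nat) : (a <= k)%N -> (p <= k)%N ->
  balanced k a (k - p) = balanced k a p.
Proof. by rewrite /balanced; lia. Qed.

Lemma balanced_flip (R : realDomainType) (n a : nat) (M : 'M[R]_(n.+1, n))
    (B : {set 'I_n.+1}) : (a <= n.+1)%N -> generic M ->
  balanced n.+1 a #|pos_dep (flip_rows B M)| =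
  balanced n.+1 a #|symdiff (pos_dep M) B|.
Proof.
move=> an genM; rewrite pos_dep_flip//; case: odd => //.
by rewrite cardsCs finset.setCK card_ord balanced_sub// -[n.+1 in X in (_ <= X)%N]card_ord max_card.
Qed.

(** Symmetric difference with [S] is an involution on subsets, so the count is that of the subsets
    of size [a] or [k - a]. *)
Lemma card_balanced (k a : nat) (S : {set 'I_k}) : (a <= k)%N ->
  #|[set B | balanced k a #|symdiff S B|]%SET| =
  ((if a == (k - a)%N then 1 else 2) * 'C(k, a))%N.
Proof.
move=> ak.
have -> : [set B | balanced k a #|symdiff S B|]%SET =
    (symdiff S @^-1: [set D : {set 'I_k} | balanced k a #|D|])%SET.
  by apply/setP => B; rewrite !inE.
rewrite on_card_preimset; last exact/onW_bij/inv_bij/symdiffK.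
have -> : [set D : {set 'I_k} | balanced k a #|D|]%SET =
    ([set D : {set 'I_k} | #|D| == a] :|:
     [set D : {set 'I_k} | #|D| == (k - a)%N])%SET.
  by apply/setP => D; rewrite !inE.
(* The two families of subsets coincide when [a] is half of [k]; otherwise they are disjoint and
   equinumerous. *)
case: eqVneq => [<-|aka]; first by rewrite finset.setUid card_draws card_ord mul1n.
rewrite cardsU !card_draws card_ord bin_sub// (_ : _ :&: _ = finset.set0)%SET.
  by rewrite cards0 subn0 mul2n addnn.
by apply/setP => D; rewrite !inE; apply/negP => /andP[/eqP ->]; rewrite (negPf aka).
Qed.

(** * Measurability of sign patterns *)

Lemma measurable_entry (R : realType) (k n : nat) (i : 'I_k) (j : 'I_n) :
  measurable_fun setT (fun M : borel_mx R k n => (M : 'M[R]_(k, n)) i j).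
Proof.
apply: (measurability _ (RGenOInfty.measurableE R)) => _ [_ [x ->] <-].
rewrite setTI; apply: sub_sigma_algebra.
by apply: open_comp (@rray_open _ _ x) => M _; exact: coord_continuous.
Qed.

Lemma measurable_dep_coef (R : realType) (dT : measure_display)
    (T : measurableType dT) (n : nat) (Y : T -> 'M[R]_(n.+1, n)) (i : 'I_n.+1) :
  (forall i j, measurable_fun setT (fun w => Y w i j)) ->
  measurable_fun setT (fun w => dep_coef (Y w) i).
Proof.
move=> mY; apply: measurable_funM => //.
apply: measurable_sum => s; apply: measurable_funM => //.
apply: measurable_prod => r _.
by rewrite (_ : (fun _ => _) = (fun w => Y w (lift i r) (s r)))//; apply/funext => w;
  rewrite mxE.
Qed.

Lemma measurable_dep_coef_neq0 (R : realType) (dT : measure_display)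
    (T : measurableType dT) (n : nat) (Y : T -> 'M[R]_(n.+1, n)) (i : 'I_n.+1) :
  (forall i j, measurable_fun setT (fun w => Y w i j)) ->
  measurable [set w | dep_coef (Y w) i != 0].
Proof.
move=> mY; have -> : [set w | dep_coef (Y w) i != 0] =
    (fun w => dep_coef (Y w) i) @^-1` (~` [set 0]).
  by apply/seteqP; split=> [w /eqP|w /eqP].
rewrite -[X in measurable X]setTI.
by apply: measurable_dep_coef => //; exact: measurableC.
Qed.

Lemma measurable_generic (R : realType) (dT : measure_display)
    (T : measurableType dT) (n : nat) (Y : T -> 'M[R]_(n.+1, n)) :
  (forall i j, measurable_fun setT (fun w => Y w i j)) ->
  measurable [set w | generic (Y w)].
Proof.
move=> mY.
have -> : [set w | generic (Y w)] = \bigcap_(i in setT) [set w | dep_coef (Y w) i != 0].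
  by apply/seteqP; split=> [w /forallP gen i _|w gen]; [exact: gen|apply/forallP => i; exact: gen].
by apply: fin_bigcap_measurable => // i _; exact: measurable_dep_coef_neq0.
Qed.

(** Only finitely many sign patterns exist, so the event is a finite union of finite intersections
    of sign conditions on single minors. *)
Lemma measurable_pos_dep (R : realType) (dT : measure_display)
    (T : measurableType dT) (n : nat) (Y : T -> 'M[R]_(n.+1, n))
    (C : pred {set 'I_n.+1}) :
  (forall i j, measurable_fun setT (fun w => Y w i j)) ->
  measurable [set w | C (pos_dep (Y w))].
Proof.
move=> mY.
have -> : [set w | C (pos_dep (Y w))] =
    \bigcup_(S in [set S | C S]) \bigcap_(i in setT)
      [set w | (0 < dep_coef (Y w) i) = (i \in S)].
  apply/seteqP; split=> [w CS|w [S CS eqS]].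
    by exists (pos_dep (Y w)) => // i _; rewrite /= inE.
  rewrite /= (_ : pos_dep (Y w) = S)//; apply/setP => i.
  by rewrite inE; exact: eqS.
apply: fin_bigcup_measurable => // S _; apply: fin_bigcap_measurable => // i _.
have -> : [set w | (0 < dep_coef (Y w) i) = (i \in S)] =
    (fun w => 0 < dep_coef (Y w) i) @^-1` [set i \in S] by [].
rewrite -[X in measurable X]setTI.
by apply: measurable_fun_ltr => //; exact: measurable_dep_coef.
Qed.

(** * Averaging over all sign changes *)

Definition balanced_signs (R : realDomainType) (n a : nat)
    (M : 'M[R]_(n.+1, n)) : bool :=
  generic M && balanced n.+1 a #|pos_dep M|.

Lemma measurable_balanced_signs (R : realType) (dT : measure_display)
    (T : measurableType dT) (n a : nat) (Y : T -> 'M[R]_(n.+1, n)) :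
  (forall i j, measurable_fun setT (fun w => Y w i j)) ->
  measurable [set w | balanced_signs a (Y w)].
Proof.
move=> mY.
have -> : [set w | balanced_signs a (Y w)] =
    [set w | generic (Y w)] `&` [set w | balanced n.+1 a #|pos_dep (Y w)|].
  by apply/seteqP; split=> w /andP.
apply: measurableI; first exact: measurable_generic.
exact: (measurable_pos_dep (fun S => balanced n.+1 a #|S|)).
Qed.

Lemma measurable_flip_rows (R : realType) (dT : measure_display)
    (T : measurableType dT) (k n : nat) (Y : T -> 'M[R]_(k, n)) (B : {set 'I_k}) :
  (forall i j, measurable_fun setT (fun w => Y w i j)) ->
  forall i j, measurable_fun setT (fun w => flip_rows B (Y w) i j).
Proof.
move=> mY i j.
have -> : (fun w => flip_rows B (Y w) i j) =
    (fun w => (-1) ^+ (i \in B) * Y w i j) by apply/funext => w; rewrite !mxE.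
exact: measurable_funM.
Qed.

(** Double counting: at each generic outcome exactly [N] sign changes give a balanced pattern, while
    by symmetry all [2 ^+ n.+1] sign changes do so with the same probability. *)
Lemma probability_balanced_signs (R : realType) (dT : measure_display)
    (T : measurableType dT) (P : probability T R) (n a : nat)
    (Y : T -> 'M[R]_(n.+1, n)) (N := ((if a == (n.+1 - a)%N then 1 else 2) * 'C(n.+1, a))%N) :
  (a <= n.+1)%N ->
  (forall i j, measurable_fun setT (fun w => Y w i j)) ->
  (forall B, P [set w | balanced_signs a (flip_rows B (Y w))] =
             P [set w | balanced_signs a (Y w)]) ->
  P [set w | generic (Y w)] = 1%E ->
  P [set w | balanced_signs a (Y w)] = (N%:R / 2 ^+ n.+1)%:E.
Proof.
move=> an mY sym gen1.
set G := [set w | generic (Y w)] in gen1.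
pose E B := [set w | balanced_signs a (flip_rows B (Y w))].
have mG : measurable G by exact: measurable_generic.
have mE B : measurable (E B).
  by apply: measurable_balanced_signs; exact: measurable_flip_rows.
have sumE : (\sum_(B : {set 'I_n.+1}) P (E B) = N%:R%:E)%E.
  transitivity (\int[P]_(w in G) (\sum_(B : {set 'I_n.+1}) (\1_(E B) w)%:E))%E.
    rewrite ge0_integral_sum//; last first.
      by move=> B; apply/measurable_EFinP/measurable_funTS/measurable_indic.
    (* Flips preserve genericity, so [E B] lies in [G] and integrating over [G] loses nothing. *)
    apply: eq_bigr => B _; rewrite integral_indic// setIidl//.
    by move=> w /andP[+ _]; rewrite generic_flip.
  rewrite (eq_integral (cst N%:R%:E)); first by rewrite integral_cst// [X in (_ * X)%E]gen1 mule1.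
  move=> w; rewrite inE => genY; rewrite sumEFin; congr (_%:E).
  rewrite /N -(card_balanced (pos_dep (Y w)) an) -sum1_card natr_sum [RHS]big_mkcond.
  apply: eq_bigr => B _; rewrite indicE inE.
  have -> : (w \in E B) = balanced_signs a (flip_rows B (Y w)).
    by apply/idP/idP; rewrite inE.
  rewrite /balanced_signs generic_flip genY balanced_flip//.
  by case: balanced.
(* By [sym] all these probabilities agree, so any index would serve; finiteness moves the equation
   from the extended reals to the reals. *)
have PE : (P [set w | balanced_signs a (Y w)] = (fine (P (E finset.set0)))%:E).
  by rewrite fineK ?fin_num_measure// sym.
move: sumE; under eq_bigr do rewrite sym PE.
rewrite PE sumEFin sumr_const => -[].
rewrite -cardsT -powersetT card_powerset cardsT card_ord => <-.
by rewrite -[X in X / _]mulr_natl natrX mulrAC divff ?mul1r// expf_neq0.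
Qed.

(** Genericity is a finite conjunction of almost sure conditions, one for each deleted row. *)
Lemma probability_generic (R : realType) (dT : measure_display)
    (T : measurableType dT) (P : probability T R) (n : nat)
    (Y : T -> 'M[R]_(n.+1, n)) :
  (forall i j, measurable_fun setT (fun w => Y w i j)) ->
  (forall i, P [set w | row_free (row' i (Y w))] = 1%E) ->
  P [set w | generic (Y w)] = 1%E.
Proof.
move=> mY free1.
have mG : measurable [set w | generic (Y w)] by exact: measurable_generic.
have /measure_negligible P0 : P.-negligible (~` [set w | generic (Y w)]).
  suff : \forall w \ae P, forall i, dep_coef (Y w) i != 0.
    by apply: negligibleS => w /= + dep; apply; apply/forallP.
  apply: filter_forall => i.
  pose D := [set w | dep_coef (Y w) i != 0].
  have mD : measurable D by exact: measurable_dep_coef_neq0.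
  have DE : D = [set w | row_free (row' i (Y w))].
    by apply/seteqP; split=> w /=; rewrite /D/= dep_coef_neq0.
  rewrite /almost_everywhere -/D; apply/negligibleP; first exact: measurableC.
  by apply: etrans (probability_setC P mD) _; rewrite DE free1 subee.
have P0' := esym (etrans (esym (P0 (measurableC mG))) (probability_setC P mG)).
rewrite -[LHS]fineK ?fin_num_measure//; congr (_%:E).
move: P0'; rewrite -[P _]fineK ?fin_num_measure// => -[] /eqP.
by rewrite subr_eq0 => /eqP.
Qed.

(* The type of [Q] is only defined for generators in general position, which is
   therefore part of the (almost surely unaffected) event. *)
Theorem theorem4p2 (R : realType) (dT : measure_display)
    (T : measurableType dT) (P : probability T R)
    (d : nat) (hd : (1 <= d)%N)
    (X : 'I_d.+2 -> T -> 'rV[R]_d.+1)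
    (X_meas : forall i, measurable_fun setT (X i : T -> borel_mx R 1 d.+1))
    (X_sym : forall eps : 'I_d.+2 -> R,
       (forall i, eps i = 1 \/ eps i = -1) ->
       same_law P (fun w => \matrix_(i < d.+2) (eps i *: X i w))
                  (fun w => \matrix_(i < d.+2) X i w))
    (X_gp : forall s : 'I_d.+1 -> 'I_d.+2, {homo s : i j / (i < j)%N} ->
       P [set w | row_free (\matrix_(i < d.+1) X (s i) w)] = 1%E)
    (m : int) (hm : -1 <= m <= (d./2)%:Z) :
  let E := [set w | general_position (fun i => X i w) /\
              of_type m (pos_hull (fun i => X i w) `&` unit_sphere R d.+1)] in
  measurable E /\
  P E = ((eta_coef d m)%:R / 2 ^+ d.+2 * 'C(d.+2, `|(m + 1)%R|)%:R)%:E.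
Proof.
move=> E.
pose Y w := \matrix_(i < d.+2) X i w; set a := `|(m + 1)%R|%N.
have ak : (a <= d.+2)%N by rewrite /a; lia.
have XE w : (fun i => X i w) = (fun i => row i (Y w)).
  by apply/funext => i; apply/rowP => k; rewrite !mxE.
have mY i j : measurable_fun setT (fun w => Y w i j).
  rewrite (_ : (fun _ => _) = (fun M : borel_mx R 1 d.+1 => (M : 'rV_d.+1) 0 j) \o X i).
    exact: measurableT_comp (measurable_entry _ _) (X_meas i).
  by apply/funext => w; rewrite !mxE.
(* This turns the geometric event into a condition on signs of minors, which also yields its
   measurability. *)
have EE : E = [set w | balanced_signs a (Y w)].
  apply/seteqP; split=> w; rewrite /E /= XE general_position_dep_coef.
    move=> [c0 /(of_type_dep_coef hd hm c0) pE].
    by apply/andP; split; [apply/forallP|case: pE => /eqP pE; rewrite /balanced pE ?orbT].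
  move=> /andP[/forallP c0 bal]; split=> //; apply/of_type_dep_coef => //.
  by case/orP: bal => /eqP; [left|right].
rewrite EE; split; first exact: measurable_balanced_signs.
rewrite (probability_balanced_signs ak mY); last first.
- apply: probability_generic => // i.
  rewrite -(X_gp _ (@lift_homo_ltn _ i)); congr (P _).
  by apply/seteqP; split=> w /=; congr (is_true (row_free _)); apply/matrixP => r k;
    rewrite !mxE.
- move=> B.
  have eps1 i : (-1) ^+ (i \in B) = 1 :> R \/ (-1) ^+ (i \in B) = -1 :> R.
    by case: (i \in B); [right|left].
  (* Equality of laws is tested on Borel sets of matrices, so the condition must be measurable on
     the matrix space itself; the identity plays the random matrix. *)
  have mA : measurable ([set M | balanced_signs a M] : set (borel_mx R d.+2 d.+1)).
    apply: (@measurable_balanced_signs R _ (borel_mx R d.+2 d.+1) d.+1 a (fun M => M)).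
    by move=> i j; exact: measurable_entry.
  have := X_sym _ eps1 _ mA; rewrite /pushforward => <-; congr (P _).
  apply/seteqP; split=> w /=; congr (is_true (balanced_signs _ _)); apply/matrixP => r k;
    by rewrite !mxE.
(* With a = m + 1, the case a = d + 2 - a is exactly 2m = d, where [eta_coef] is 1. *)
congr (_%:E); rewrite natrM mulrAC; congr (_%:R / _ * _).
by rewrite /eta_coef; congr (if _ then _ else _); rewrite /a; lia.
Qed.
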